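(* Let $\mathcal{A}$ and $\mathcal{B}$ be unital C*-algebras and let $T\in\mathcal{A}\otimes\mathcal{B}$ be a positive contraction. (i) The function $$S(\mathcal{A})\times S(\mathcal{B})\to\mathbb{R}_+;\quad(\phi,\psi)\mapsto\alpha_{\phi,\psi}(T),$$ is upper semicontinuous (with respect to the weak* topologies on $S(\mathcal{A})$ and $S(\mathcal{B})$). (ii) If $\mathcal{A}$ and $\mathcal{B}$ are finite dimensional, then the function $$S_{\rm f}(\mathcal{A})\times S_{\rm f}(\mathcal{B})\to\mathbb{R}_+;\quad(\phi,\psi)\mapsto\alpha_{\phi,\psi}(T),$$ is continuous.
   Context: $\mathcal{A}\otimes\mathcal{B}$ is the minimal C*-tensor product. $S(\mathcal{A})$ is the set of all states of $\mathcal{A}$ and $S_{\rm f}(\mathcal{A})\subseteq S(\mathcal{A})$ the set of faithful states. For $\phi\in S(\mathcal{A})$ and $\psi\in S(\mathcal{B})$, $\mathsf{C}(\phi,\psi)$ is the set of positive functionals $\sigma$ on $\mathcal{A}\otimes\mathcal{B}$ with $\sigma(a\otimes 1)=\phi(a)$ for all $a\in\mathcal{A}$ and $\sigma(1\otimes b)=\psi(b)$ for all $b\in\mathcal{B}$, and $\alpha_{\phi,\psi}(T)=\sup\{\sigma(T):\sigma\in\mathsf{C}(\phi,\psi)\}$. *)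

(* Defs.v *)
From HB Require Import structures.
From mathcomp Require Import all_boot all_order all_algebra.
From mathcomp Require Import all_classical all_reals all_analysis.
From mathcomp Require Import complex.

Set Implicit Arguments.
Unset Strict Implicit.
Unset Printing Implicit Defensive.

Import Order.TTheory GRing.Theory Num.Theory.
Import numFieldNormedType.Exports.

Local Open Scope classical_set_scope.
Local Open Scope ring_scope.

(* The metric topology of the complex plane, inherited from the generic one
   on a numClosedFieldType. *)
HB.instance Definition _ (R : rcfType) :=
  NormedModule.copy R[i] (R[i] : numClosedFieldType)^o.

(* Unital C*-algebras.  The norm is a real-valued function of the mixin, not
   the norm of a normedModType: the library has no join of its normed-module
   and ring hierarchies below numDomainType, so that the two cannot be combined
   in one structure.  As for every algType, 1 != 0. *)
HB.mixin Record isCStarAlgebra (R : realType) A & GRing.Algebra R[i] A := {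
  star : A -> A;
  starK : involutive star;
  starD : {morph star : x y / x + y};
  starZ : forall (k : R[i]) (x : A), star (k *: x) = Num.conj k *: star x;
  starM : forall x y : A, star (x * y) = star y * star x;
  cnorm : A -> R;
  cnorm0_eq0 : forall x, cnorm x = 0 -> x = 0;
  cnormD : forall x y : A, cnorm (x + y) <= cnorm x + cnorm y;
  cnormZ : forall (k : R[i]) (x : A), cnorm (k *: x) = complex.Re `|k| * cnorm x;
  cnormM : forall x y : A, cnorm (x * y) <= cnorm x * cnorm y;
  cnorm_star : forall x, cnorm (star x * x) = cnorm x ^+ 2;
  cnorm_complete : forall u : nat -> A,
    (forall e : R, 0 < e -> exists N, forall m n, (N <= m)%N -> (N <= n)%N ->
       cnorm (u m - u n) < e) ->
    exists l, cnorm (u n - l) @[n --> \oo] --> (0 : R)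
}.

#[short(type="cstarAlgType")]
HB.structure Definition CStarAlgebra (R : realType) :=
  {A of GRing.Algebra R[i] A & isCStarAlgebra R A}.

Section CStar.
Context {R : realType}.
Implicit Types A B C D : cstarAlgType R.

Definition positive A (x : A) : Prop := exists y, x = star y * y.

Definition finite_dimensional A : Prop :=
  exists (n : nat) (e : 'I_n -> A),
    forall x, exists c : 'I_n -> R[i], x = \sum_(i < n) c i *: e i.

(* [0 <= z] in R[i] means that z is real and nonnegative. *)
Definition positive_functional A (f : A -> R[i]) : Prop :=
  scalar f /\ forall x, positive x -> 0 <= f x.

Definition is_state A (f : A -> R[i]) : Prop :=
  positive_functional f /\ f 1 = 1.

Definition is_faithful A (f : A -> R[i]) : Prop :=
  forall x, positive x -> f x = 0 -> x = 0.

(* As subsets of the space of all functions with the topology of pointwise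
   convergence, the types [states A] and [faithful_states A] carry the
   weak* topology. *)
Definition states A : set {ptws A -> R[i]} := [set f | is_state f].

Definition faithful_states A : set {ptws A -> R[i]} :=
  [set f | is_state f /\ is_faithful f].

(* The value in V, under the linear map induced by the bilinear map t, of the
   element of the algebraic tensor product of A and B that is represented by
   the formal sum s of elementary tensors. *)
Definition tensor_sum A B (V : lmodType R[i]) (t : {bilinear A -> B -> V})
  (s : seq (A * B)) : V := \sum_(p <- s) t p.1 p.2.

(* s represents 0 in the algebraic tensor product of A and B. *)
Definition tensor_eq0 A B (s : seq (A * B)) : Prop :=
  forall (V : lmodType R[i]) (f : {bilinear A -> B -> V}), tensor_sum f s = 0.

(* C is the completion of the algebraic tensor product of A and B for some
   C*-norm, with t a b the image of the elementary tensor of a and b: the map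
   induced by t is an injective unital *-homomorphism with dense range. *)
Record is_cstar_tensor A B C (t : {bilinear A -> B -> C}) : Prop := {
  tensor1 : t 1 1 = 1;
  tensorM : forall a a' b b', t (a * a') (b * b') = t a b * t a' b';
  tensor_star : forall a b, t (star a) (star b) = star (t a b);
  tensor_inj : forall s, tensor_sum t s = 0 -> tensor_eq0 s;
  tensor_dense : forall (x : C) (e : R), 0 < e ->
    exists s, cnorm (x - tensor_sum t s) < e
}.

(* The minimal tensor product: the completion for the least C*-norm. *)
Definition is_min_cstar_tensor A B C (t : {bilinear A -> B -> C}) : Prop :=
  is_cstar_tensor t /\
  forall D (u : {bilinear A -> B -> D}), is_cstar_tensor u ->
    forall s, cnorm (tensor_sum t s) <= cnorm (tensor_sum u s).

Section Couplings.
Variables (A B C : cstarAlgType R) (t : {bilinear A -> B -> C}).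

Definition couplings (phi : A -> R[i]) (psi : B -> R[i]) : set (C -> R[i]) :=
  [set sigma | [/\ positive_functional sigma,
                   forall a, sigma (t a 1) = phi a &
                   forall b, sigma (t 1 b) = psi b]].

(* sigma T is real whenever T is positive. *)
Definition alpha (phi : A -> R[i]) (psi : B -> R[i]) (T : C) : R :=
  sup [set complex.Re (sigma T) | sigma in couplings phi psi].

End Couplings.

Definition upper_semicontinuous (X : topologicalType) (f : X -> R) : Prop :=
  forall x (a : R), f x < a -> \forall y \near x, f y < a.

End CStar.

Arguments states {R} A.
Arguments faithful_states {R} A.
Arguments finite_dimensional {R} A.

(* Main.v *)
(* (i) The states of C form a weak*-compact set: Tychonoff applies because a
   state is bounded at each point by a constant that does not depend on it.
   Hence the states s with Re (s T) >= c have a weak*-closed set of pairs of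
   marginals; a pair with alpha < c lies outside it, and off this set
   alpha <= c.  An empty set of couplings is harmless here, since then
   alpha = 0.

   (ii) Let s be a coupling of faithful states phi and psi, with s T almost
   optimal.  In finite dimension, a state phi' near phi satisfies
   phi' >= (1 - e) phi, and even phi1 := phi' - (1 - e) phi is faithful; define
   psi1 likewise.  Then (1 - e) s + e^-1 (phi1 (x) psi1) is a coupling of phi'
   and psi' with value at least (1 - e) s T at T.  Both the domination and the
   positivity of phi1 (x) psi1 are read off in a basis of A that is orthonormal
   for the inner product (x, y) |-> f (x^* y) of a faithful functional f. *)

Require Import Defs.
From HB Require Import structures.
From mathcomp Require Import all_boot all_order all_algebra.
From mathcomp Require Import all_classical all_reals all_analysis.
From mathcomp Require Import complex.
From mathcomp Require Import ring lra.

Set Implicit Arguments.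
Unset Strict Implicit.
Unset Printing Implicit Defensive.

Import Order.TTheory GRing.Theory Num.Theory.
Import numFieldNormedType.Exports.

Local Open Scope classical_set_scope.
Local Open Scope ring_scope.

(** * C*-norms and positive functionals *)

Section CStarNorm.
Context {R : realType} (A : cstarAlgType R).
Implicit Types x y h : A.

Lemma star0 : star (0 : A) = 0.
Proof. by rewrite -(scale0r (0 : A)) starZ conjC0 !scale0r. Qed.

Lemma starN x : star (- x) = - star x.
Proof. by rewrite -scaleN1r starZ rmorphN1 scaleN1r. Qed.

Lemma star1 : star (1 : A) = 1.
Proof. by rewrite -[LHS]mulr1 -[X in _ * X]starK -starM mulr1 starK. Qed.

Lemma cnorm_scale_real (r : R) x :
  0 <= r -> cnorm (real_complex R r *: x) = r * cnorm x.
Proof. by move=> r0; rewrite cnormZ ger0_norm ?ler0c. Qed.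

Lemma cnorm0 : cnorm (0 : A) = 0.
Proof. by rewrite -(scale0r (0 : A)) cnormZ normr0 mul0r. Qed.

Lemma cnormN x : cnorm (- x) = cnorm x.
Proof. by rewrite -scaleN1r cnormZ normrN1; exact: mul1r. Qed.

Lemma cnorm_ge0 x : 0 <= cnorm x.
Proof. by have := cnormD x (- x); rewrite subrr cnorm0 cnormN; lra. Qed.

Lemma cnormBC x y : cnorm (x - y) = cnorm (y - x).
Proof. by rewrite -cnormN opprB. Qed.

Lemma cnorm_triangle y x z : cnorm (x - z) <= cnorm (x - y) + cnorm (y - z).
Proof. by rewrite (le_trans _ (cnormD _ _)) // addrA subrK. Qed.

(** The C*-identity gives [cnorm y ^+ 2 <= cnorm (star y) * cnorm y]. Cancelling [cnorm y], for
    [y = x] and for [y = star x], yields both inequalities. *)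
Lemma cnorm_starE x : cnorm (star x) = cnorm x.
Proof.
suff le_star y : cnorm y <= cnorm (star y).
  by apply/le_anti; rewrite le_star -{2}[x]starK le_star.
have [->|y0] := eqVneq y 0; first by rewrite star0.
have ny : 0 < cnorm y.
  rewrite lt_neqAle cnorm_ge0 andbT eq_sym.
  by apply: contra_neq y0; exact: cnorm0_eq0.
by rewrite -(ler_pM2r ny) -expr2 -cnorm_star; exact: cnormM.
Qed.

Lemma cnormM_diff x y :
  cnorm (x * x - y * y) <= (cnorm x + cnorm y) * cnorm (x - y).
Proof.
have -> : x * x - y * y = x * (x - y) + (x - y) * y.
  by rewrite mulrBr mulrBl addrA subrK.
have := cnormD (x * (x - y)) ((x - y) * y).
have := cnormM x (x - y); have := cnormM (x - y) y; lra.
Qed.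

Lemma star_mul_self_eq0 x : star x * x = 0 -> x = 0.
Proof.
move=> x0; apply: cnorm0_eq0; apply/eqP.
by have /eqP := cnorm_star x; rewrite x0 cnorm0 eq_sym expf_eq0.
Qed.

(* A square root [1 - y] of [1 - h]: the map [y |-> (h + y^2) / 2] contracts
   the ball of radius 1/2. *)
Lemma one_sub_square h : star h = h -> cnorm h <= 2^-1 ->
  exists s : A, 1 - h = star s * s.
Proof.
move=> hsa hle.
pose F y : A := real_complex R 2^-1 *: (h + y * y).
pose u n := iter n F 0.
have half_ge0 : 0 <= 2^-1 :> R by lra.
(* On the ball of radius 1/2 the factor [cnorm x + cnorm y] is at most 1, so [F] contracts distances
   there by 1/2. *)
have FE x y : cnorm (F x - F y) <= 2^-1 * ((cnorm x + cnorm y) * cnorm (x - y)).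
  rewrite /F -scalerBr opprD addrACA subrr add0r cnorm_scale_real //.
  by rewrite ler_wpM2l // cnormM_diff.
have usm n : cnorm (u n) <= 2^-1.
  elim: n => [|n IH]; first by rewrite /= cnorm0.
  rewrite /= -/(u n) cnorm_scale_real //.
  have := cnormD h (u n * u n); have := cnormM (u n) (u n).
  have := cnorm_ge0 (u n); nra.
have uc k n : cnorm (u (n + k)%N - u n) <= 2^-1 ^+ n.
  elim: n => [|n IH].
    by rewrite add0n expr0 /= subr0 (le_trans (usm k)) //; lra.
  rewrite addSn /= -/(u n) -/(u (n + k)%N) (le_trans (FE _ _)) // exprS.
  rewrite ler_wpM2l // (le_trans _ IH) // ler_piMl ?cnorm_ge0 //.
  have := usm n; have := usm (n + k)%N; lra.
have usa n : star (u n) = u n.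
  elim: n => [|n IH]; first exact: star0.
  by rewrite /= -/(u n) /F starZ starD starM IH hsa conj_Creal // complex_real.
have ucauchy e : 0 < e -> exists N, forall m n, (N <= m)%N -> (N <= n)%N ->
    cnorm (u m - u n) < e.
  move=> e0.
  have /cvgrPdist_lt /(_ (e / 2)) : (2^-1 : R) ^+ n @[n --> \oo] --> (0 : R).
    by apply: cvg_expr; rewrite ger0_norm //; lra.
  case=> [|N _ HN]; first by lra.
  have := HN N (leqnn N).
  rewrite /= sub0r normrN ger0_norm ?exprn_ge0 // => lt2.
  exists N => m n Nm Nn.
  have := cnorm_triangle (u N) (u m) (u n).
  have := uc (m - N)%N N; have := uc (n - N)%N N; rewrite !subnKC //.
  rewrite (cnormBC (u n)); lra.
have [l ul] := cnorm_complete u ucauchy.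
have ule e : 0 < e -> exists n, cnorm (u n - l) < e /\ cnorm (u n.+1 - l) < e.
  move=> e0; move/cvgrPdist_lt: ul => /(_ _ e0) [N _ HN].
  exists N; have := HN N (leqnn N); have := HN N.+1 (leqnSn N).
  by rewrite /= !sub0r !normrN !ger0_norm ?cnorm_ge0.
have eq0_small (v : A) (K : R) : 0 < K ->
    (forall e, 0 < e -> cnorm v <= K * e) -> v = 0.
  move=> K0 small; apply: cnorm0_eq0; apply/le_anti; rewrite cnorm_ge0 andbT.
  apply/ler_addgt0Pr => e e0; rewrite add0r.
  by rewrite (le_trans (small (e / K) _)) ?divr_gt0 // mulrC divfK ?gt_eqF.
have lsa : star l = l.
  apply/eqP; rewrite -subr_eq0; apply/eqP; apply: (eq0_small _ 2) => [|e e0].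
    by lra.
  have [n [n1 _]] := ule e e0.
  have := cnorm_triangle (u n) (star l) l.
  have -> : cnorm (star l - u n) = cnorm (u n - l).
    by rewrite -(usa n) -starN -starD cnorm_starE cnormBC usa.
  lra.
have Fl : F l = l.
  apply/eqP; rewrite -subr_eq0; apply/eqP.
  apply: (eq0_small _ (cnorm l + 2)) => [|e e0].
    by have := cnorm_ge0 l; lra.
  have [n [n1 n2]] := ule e e0.
  have := cnorm_triangle (u n.+1) (F l) l.
  have := FE l (u n); rewrite -[F (u n)]/(u n.+1) (cnormBC l).
  have := usm n; have := cnorm_ge0 l; have := cnorm_ge0 (u n - l).
  by have := cnorm_ge0 (u n); nra.
(* The fixed point equation reads [h = l + l - l * l], which is [1 - h = (1 - l) * (1 - l)]. *)
exists (1 - l); rewrite starD starN star1 lsa mulrBr mulr1 mulrBl mul1r.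
have -> : h = l + l - l * l.
  rewrite -{1 2}Fl -scalerDl /F.
  rewrite -rmorphD /= -[_ + _ : R]/(_ + _).
  have -> : 2^-1 + 2^-1 = 1 :> R by lra.
  by rewrite scale1r addrK.
by rewrite !opprD opprK !addrA.
Qed.

End CStarNorm.

Section ScalarMap.
Context {K : comNzRingType} {V : lmodType K} (f : V -> K) (lf : scalar f).

Lemma scalar_mapD x y : f (x + y) = f x + f y.
Proof. by rewrite -{1}[x]scale1r lf mul1r. Qed.

Lemma scalar_map0 : f 0 = 0.
Proof. by apply: (addrI (f 0)); rewrite -scalar_mapD !addr0. Qed.

Lemma scalar_mapZ k x : f (k *: x) = k * f x.
Proof. by rewrite -[k *: x]addr0 lf scalar_map0 addr0. Qed.

Lemma scalar_mapN x : f (- x) = - f x.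
Proof. by rewrite -scaleN1r scalar_mapZ mulN1r. Qed.

Lemma scalar_mapB x y : f (x - y) = f x - f y.
Proof. by rewrite scalar_mapD scalar_mapN. Qed.

Lemma scalar_map_sum (I : Type) (r : seq I) (P : pred I) (F : I -> V) :
  f (\sum_(i <- r | P i) F i) = \sum_(i <- r | P i) f (F i).
Proof. exact: (big_morph f scalar_mapD scalar_map0). Qed.

End ScalarMap.

(** * Adjoints and uniform bounds for positive functionals *)

Section PositiveFunctional.
Context {R : realType} (A : cstarAlgType R).
Implicit Types (x y : A) (f : A -> R[i]).

Lemma positive_functional_ge0 f x :
  positive_functional f -> 0 <= f (star x * x).
Proof. by case=> _; apply; exists x. Qed.

Lemma positive_functional_polar f x l : positive_functional f ->
  f (star (x + l *: 1) * (x + l *: 1)) =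
    f (star x * x) + l * f (star x) + l^* * f x + l * l^* * f 1.
Proof.
case=> lf _; rewrite starD starZ star1 mulrDl !mulrDr -!scalerAl -!scalerAr.
rewrite !mulr1 !mul1r scalerA !(scalar_mapD lf, scalar_mapZ lf).
by rewrite addrA [l^* * l]mulrC -mulrA.
Qed.

(** By polarization, [l * f (star x) + l^* * f x] is real for [l] of modulus 1. With [l = 1] the sum
    of [f (star x)] and [f x] is real; with [l = 'i] their difference is purely imaginary. *)
Lemma positive_functional_star f x :
  positive_functional f -> f (star x) = (f x)^*.
Proof.
move=> pf; have f1_real : f 1 \is Num.real.
  by rewrite ger0_real // -[1]mulr1 -{1}star1 positive_functional_ge0.
have fx_real : f (star x * x) \is Num.real.
  by rewrite ger0_real // positive_functional_ge0.
have real_part l : l * l^* = 1 -> l * f (star x) + l^* * f x \is Num.real.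
  move=> l1; have := positive_functional_ge0 (x + l *: 1) pf.
  move/ger0_real; rewrite positive_functional_polar // l1 mul1r rpredDr //.
  by rewrite -addrA rpredDl.
have /CrealP := real_part 1 ltac:(by rewrite conjC1 mulr1).
rewrite conjC1 !mul1r rmorphD /= => h1.
have ii : 'i * 'i = -1 :> R[i] by rewrite -expr2 sqrCi.
have /CrealP := real_part 'i ltac:(by rewrite conjCi mulrN ii opprK).
rewrite rmorphD !rmorphM /= conjCK conjCi !mulNr -!mulrN -!mulrDr.
move/(mulfI (neq0Ci _)) => h2.
suff : 2 * f (star x) = 2 * (f x)^* by move/mulfI; apply; rewrite pnatr_eq0.
have -> : 2 * f (star x) = (f (star x) + f x) + (f (star x) - f x) by ring.
by rewrite -h1 -h2; ring.
Qed.

(** The factor 2 scales [star y * y] to norm 1/2, the range in which [one_sub_square] provides a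
    square root; [f] is then nonnegative at the resulting square. *)
Lemma positive_functional_le f y : positive_functional f ->
  f (star y * y) <= real_complex R (2 * cnorm y ^+ 2) * f 1.
Proof.
move=> pf; have [->|y0] := eqVneq y 0.
  rewrite mulr0 (scalar_map0 pf.1) cnorm0 expr0n /= mulr0 rmorph0 mul0r.
  by [].
set k : R := 2 * cnorm y ^+ 2.
have k0 : 0 < k.
  rewrite mulr_gt0 ?ltr0n // exprn_gt0 // lt_neqAle cnorm_ge0 andbT eq_sym.
  by apply: contra_neq y0; exact: cnorm0_eq0.
have kV0 : 0 <= k^-1 by rewrite invr_ge0 ltW.
have [||s hs] := @one_sub_square _ _ (real_complex R k^-1 *: (star y * y)).
- by rewrite starZ conj_Creal ?complex_real // starM starK.
- rewrite cnorm_scale_real // cnorm_star /k invfM mulfVK //.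
  by move: k0; rewrite /k pmulr_rgt0 ?ltr0n // => /lt0r_neq0.
have := positive_functional_ge0 s pf; rewrite -hs.
rewrite (scalar_mapB pf.1) (scalar_mapZ pf.1) subr_ge0.
rewrite -(ler_pM2l (_ : 0 < real_complex R k)); last by rewrite ltcR.
by rewrite mulrA -rmorphM /= divff ?gt_eqF // mul1r.
Qed.

(** The bound is chosen before [f]: this uniformity places all states in one product of bounded
    sets. *)
Lemma positive_functional_bounded x : exists M : R, forall f,
  positive_functional f -> f 1 = 1 -> `|f x| <= real_complex R M.
Proof.
pose m l : R := 2 * cnorm (x + l *: 1) ^+ 2.
exists (m 1 + m (-1) + m 'i + m (- 'i)) => f pf f1.
pose p l := f (star (x + l *: 1) * (x + l *: 1)).
have p0 l : 0 <= p l by exact: positive_functional_ge0.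
have pm l : p l <= real_complex R (m l).
  by rewrite -[leRHS]mulr1 -f1 positive_functional_le.
have ii : 'i * 'i = -1 :> R[i] by rewrite -expr2 sqrCi.
(* Polarization: [4 x] is a combination of the squares of [x + l], [l^4 = 1]. *)
have e4 : 4 * f x = p 1 - p (-1) + 'i * p 'i - 'i * p (- 'i).
  rewrite /p !positive_functional_polar // rmorphN !rmorph1 rmorphN /= conjCi.
  set a := f (star x * x); set b := f (star x).
  have -> : forall i : R[i], a + 1 * b + 1 * f x + 1 * 1 * f 1 -
      (a + -1 * b + -1 * f x + -1 * -1 * f 1) +
      i * (a + i * b + - i * f x + i * - i * f 1) -
      i * (a + - i * b + - - i * f x + - i * - - i * f 1) =
      2 * b + 2 * f x + 2 * (i * i) * (b - f x) by move=> i; ring.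
  by rewrite ii; ring.
have : `|4 * f x| <= p 1 + p (-1) + p 'i + p (- 'i).
  rewrite e4; do 3 ?[apply: (le_trans (ler_normD _ _)); apply: lerD].
  - by rewrite ger0_norm.
  - by rewrite normrN ger0_norm.
  - by rewrite normrM normCi mul1r ger0_norm.
  - by rewrite normrN normrM normCi mul1r ger0_norm.
rewrite normrM [`|4|]ger0_norm // => le4.
have le1 : `|f x| <= 4 * `|f x| by rewrite ler_peMl // ler1n.
by rewrite (le_trans le1) // (le_trans le4) // !rmorphD /= !lerD.
Qed.

End PositiveFunctional.

(** * Upper semicontinuity *)

Section PointwiseTopology.
Context {X V : topologicalType} {I : eqType}.

Lemma continuous_eval (i : I) : continuous (fun f : {ptws I -> V} => f i).
Proof. exact: proj_continuous. Qed.

Lemma continuous_ptws (g : X -> {ptws I -> V}) :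
  (forall i, continuous (fun x => g x i)) -> continuous g.
Proof.
move=> gc x; apply/cvg_sup => i W [B [[D oD <-] Dgx] DW].
have : nbhs x ((fun x => g x i) @^-1` D) by apply: gc; exact: open_nbhs_nbhs.
by apply: filterS => y Dy; exact: DW.
Qed.

End PointwiseTopology.

Lemma hausdorff_prod (X Y : topologicalType) :
  hausdorff_space X -> hausdorff_space Y -> hausdorff_space (X * Y)%type.
Proof.
move=> hX hY [x1 y1] [x2 y2] cl; congr pair.
- apply: hX => B D B1 D2.
  have [[x y] [/= Bx Dx]] := cl (fst @^-1` B) (fst @^-1` D)
    (@cvg_fst _ _ _ _ _ _ B1) (@cvg_fst _ _ _ _ _ _ D2).
  by exists x.
- apply: hY => B D B1 D2.
  have [[x y] [/= By Dy]] := cl (snd @^-1` B) (snd @^-1` D)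
    (@cvg_snd _ _ _ _ _ _ B1) (@cvg_snd _ _ _ _ _ _ D2).
  by exists y.
Qed.

Lemma closed_forall (X : topologicalType) (I : Type) (P : I -> set X) :
  (forall i, closed (P i)) -> closed [set x | forall i, P i x].
Proof.
move=> cP; rewrite (_ : mkset _ = \bigcap_i P i).
  by apply: closed_bigI => i _; exact: cP.
by rewrite eqEsubset; split=> x Px i //; apply: Px.
Qed.

(** * Topology of the complex plane *)

Section ComplexTopology.
Context {R : realType}.

Lemma normc_le_ReIm (a b : R) : `|a +i* b|%C <= real_complex R (`|a| + `|b|).
Proof.
rewrite [X in `|X|]complexE /= rmorphD /=.
rewrite (le_trans (ler_normD _ _)) // lerD //.
  by rewrite normc_def /= expr0n /= addr0 sqrtr_sqr.
by rewrite normrM complexiE normCi mul1r normc_def /= expr0n /= addr0 sqrtr_sqr.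
Qed.

Lemma normc_ge_Im (z : R[i]) : real_complex R `|complex.Im z| <= `|z|.
Proof.
have := normc_ge_Re (z * 'i%C).
by rewrite ReiNIm normrN normrM complexiE normCi mulr1.
Qed.

Lemma continuous_complex (X : topologicalType) (f g : X -> R) :
  continuous f -> continuous g -> continuous (fun x => (f x +i* g x)%C : R[i]).
Proof.
move=> cf cg x; apply/cvgrPdist_lt => e e0.
have [d d0 ->] : exists2 d : R, 0 < d & e = real_complex R d.
  exists (complex.Re e); first by move: e0; rewrite ltcE /= => /andP[].
  by rewrite RRe_real ?gtr0_real.
have d2 : 0 < d / 2 by lra.
have /cvgrPdist_lt/(_ _ d2) := cf x.
have /cvgrPdist_lt/(_ _ d2) := cg x.
apply: filterS2 => y gy fy.
rewrite (le_lt_trans (normc_le_ReIm (f x - f y) (g x - g y))) // ltcR; lra.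
Qed.

Lemma continuous_Re : continuous (@complex.Re R : R[i] -> R).
Proof.
move=> z; apply/(@cvgrPdist_lt _ _ _ (nbhs z)) => e e0.
have : \forall y \near z, `|z - y| < real_complex R e.
  by apply/nbhs_normP; exists (real_complex R e) => //=; rewrite ltcR.
apply: filterS => y.
rewrite -ltcR; apply: le_lt_trans; case: z y => [a b] [c d].
exact: normc_ge_Re ((a - c) +i* (b - d))%C.
Qed.

Lemma continuous_Im : continuous (@complex.Im R : R[i] -> R).
Proof.
move=> z; apply/(@cvgrPdist_lt _ _ _ (nbhs z)) => e e0.
have : \forall y \near z, `|z - y| < real_complex R e.
  by apply/nbhs_normP; exists (real_complex R e) => //=; rewrite ltcR.
apply: filterS => y.
rewrite -ltcR; apply: le_lt_trans; case: z y => [a b] [c d].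
exact: normc_ge_Im ((a - c) +i* (b - d))%C.
Qed.

(** A square instead of a disc: it is the continuous image of a product of two segments, hence
    compact. *)
Definition complex_box (M : R) : set R[i] :=
  [set z | `|complex.Re z| <= M /\ `|complex.Im z| <= M].

Lemma compact_complex_box (M : R) : compact (complex_box M).
Proof.
have -> : complex_box M =
    (fun p : R * R => (p.1 +i* p.2)%C) @` (`[- M, M] `*` `[- M, M]).
  rewrite eqEsubset; split=> [[a b] [/= ha hb]|_ [[a b] [/= ha hb] <-]].
    by exists (a, b) => //=; split; rewrite /= in_itv /= -ler_norml.
  by split; rewrite /= ler_norml; [move: ha|move: hb]; rewrite in_itv.
apply: continuous_compact; last by apply: compact_setX; exact: segment_compact.
apply: continuous_subspaceT; apply: continuous_complex => p.
  exact: cvg_fst.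
exact: cvg_snd.
Qed.

Lemma closed_ge0c : closed [set z : R[i] | 0 <= z].
Proof.
have -> : [set z : R[i] | 0 <= z] =
    @complex.Im R @^-1` [set x : R | x = 0] `&`
    @complex.Re R @^-1` [set x : R | 0 <= x].
  rewrite eqEsubset; split=> z; rewrite /= lecE /=.
    by move=> /andP[/eqP].
  by move=> [-> ->]; rewrite eqxx.
apply: closedI; apply: preimage_closed.
- by move=> z _; exact: continuous_Im.
- exact: closed_eq.
- by move=> z _; exact: continuous_Re.
- exact: closed_ge.
Qed.

End ComplexTopology.

(** A Banach-Alaoglu argument: the set is closed in a product of boxes whose sizes are the bounds
    common to all states. *)
Lemma compact_states_ge (R : realType) (C : cstarAlgType R) (T : C) (a : R) :
  compact [set s : {ptws C -> R[i]} | is_state s /\ a <= complex.Re (s T)].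
Proof.
have /choice[M hM] x := @positive_functional_bounded R C x.
have cev (x : C) : continuous (fun s : {ptws C -> R[i]} => s x).
  exact: continuous_eval.
pose box := [set s : {ptws C -> R[i]} | forall x, complex_box (M x) (s x)].
have cbox : compact box.
  apply: (@tychonoff C (fun=> R[i]) (fun x => complex_box (M x))) => x.
  exact: compact_complex_box.
apply: (subclosed_compact _ cbox); last first.
  move=> s [[ps s1] _] x; have sM := hM x s ps s1.
  by split; rewrite -lecR (le_trans _ sM) ?normc_ge_Re ?normc_ge_Im.
have cl0 (g : {ptws C -> R[i]} -> R[i]) :
    continuous g -> closed [set s | g s = 0].
  move=> cg; apply: (@preimage_closed _ _ g [set 0]) => [s _|]; first exact: cg.
  by apply/accessible_closed_set1/hausdorff_accessible/norm_hausdorff.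
(* An intersection of closed conditions, each of which involves only finitely many evaluations of
   [s]. *)
have -> : [set s : {ptws C -> R[i]} | is_state s /\ a <= complex.Re (s T)] =
  [set s | forall k x y, s (k *: x + y) - (k * s x + s y) = 0] `&`
  [set s | forall x : {x : C | positive x}, 0 <= s (sval x)] `&`
  [set s | s 1 - 1 = 0] `&` [set s | a <= complex.Re (s T)].
  rewrite eqEsubset; split=> s.
    move=> [[[ls ps] s1] sT]; split=> //; split; last by rewrite /= s1 subrr.
    by split=> [k x y /=|[x px] /=]; [rewrite ls subrr|exact: ps].
  move=> [[[ls ps] s1] sT]; split=> //; split; last exact/eqP/eqP/subr0_eq.
  split; last by move=> x px; exact: (ps (exist _ x px)).
  by move=> k x y; exact/subr0_eq/ls.
apply: closedI; last first.
  apply: (@preimage_closed _ _ (fun s : {ptws C -> R[i]} => complex.Re (s T))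
    [set r | a <= r]).
    by move=> s _; apply: continuous_comp; [exact: cev|exact: continuous_Re].
  exact: closed_ge.
apply: closedI; last first.
  apply: (cl0 (fun s => s 1 - 1)) => s.
    apply: (@cvgB _ _ _ (nbhs s) _ (fun s => s 1) (fun=> 1)).
      exact: cev.
    exact: cvg_cst.
apply: closedI.
  apply: closed_forall => k; apply: closed_forall => x.
  apply: closed_forall => y.
  apply: (cl0 (fun s => s (k *: x + y) - (k * s x + s y))) => s.
  apply: (@cvgB _ _ _ (nbhs s) _ (fun s => s (k *: x + y))
    (fun s => k * s x + s y)); first exact: cev.
  apply: (@cvgD _ _ _ (nbhs s) _ (fun s => k * s x) (fun s => s y)).
    apply: (@cvgM _ _ (nbhs s) _ (fun=> k) (fun s => s x)).
      exact: cvg_cst.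
    exact: cev.
  exact: cev.
apply: closed_forall => x.
apply: (@preimage_closed _ _ (fun s : {ptws C -> R[i]} => s (sval x))
  [set z | 0 <= z]).
  by move=> s _; exact: cev.
exact: closed_ge0c.
Qed.

(** * Values of couplings and their supremum *)

Section Alpha.
Context {R : realType} (A B C : cstarAlgType R) (t : {bilinear A -> B -> C}).
Hypothesis t11 : t 1 1 = 1.
Implicit Types (phi : A -> R[i]) (psi : B -> R[i]) (T : C).

Lemma coupling_is_state phi psi s :
  phi 1 = 1 -> couplings t phi psi s -> is_state s.
Proof. by move=> phi1 [ps sA _]; split; rewrite // -t11 sA. Qed.

Lemma alpha_ge0 phi psi T : positive T -> 0 <= alpha t phi psi T.
Proof.
move=> pT; rewrite /alpha; set E := (X in sup X).
(* By convention [sup] is 0 on a set that is empty or unbounded above. *)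
have [[[x Ex] ubE]|/sup_out -> //] := pselect (has_sup E).
rewrite (le_trans _ (ub_le_sup ubE Ex)) //.
by case: Ex => s [ps _ _] <-; have := ps.2 _ pT; rewrite lecE => /andP[].
Qed.

Lemma le_alpha phi psi T s : phi 1 = 1 -> couplings t phi psi s ->
  complex.Re (s T) <= alpha t phi psi T.
Proof.
move=> phi1 cs; apply: ub_le_sup; last by exists s.
have [M hM] := positive_functional_bounded T.
exists M => _ [u /(coupling_is_state phi1)[pu u1] <-].
rewrite (le_trans (ler_norm _)) // -lecR (le_trans (normc_ge_Re _)) //.
exact: hM.
Qed.

(** The neighbourhood is taken among all pairs of functions; the condition [p.1 1 = 1] makes every
    coupling of the pair a state. *)
Lemma alpha_upper_semicontinuous phi psi T (a : R) :
  positive T -> phi 1 = 1 -> alpha t phi psi T < a ->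
  \forall p \near ((phi, psi) : {ptws A -> R[i]} * {ptws B -> R[i]}),
    p.1 1 = 1 -> alpha t p.1 p.2 T < a.
Proof.
move=> pT phi1 lta; have alpha0 := alpha_ge0 phi psi pT.
(* A supremum preserves only weak bounds, so the values nearby are bounded by a midpoint that is
   strictly below [a]. *)
pose c := (alpha t phi psi T + a) / 2.
pose K := [set s : {ptws C -> R[i]} | is_state s /\ c <= complex.Re (s T)].
pose margA (s : {ptws C -> R[i]}) : {ptws A -> R[i]} := fun x => s (t x 1).
pose margB (s : {ptws C -> R[i]}) : {ptws B -> R[i]} := fun y => s (t 1 y).
pose marg s := (margA s, margB s).
have cmarg : continuous marg.
  have cA : continuous margA.
    by apply: continuous_ptws => x; exact: continuous_eval.
  have cB : continuous margB.
    by apply: continuous_ptws => y; exact: continuous_eval.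
  by move=> s; exact: (cvg_pair (cA s) (cB s)).
have closed_margK : closed (marg @` K).
  apply: compact_closed.
    apply: hausdorff_prod; apply: hausdorff_product => ?;
    exact: norm_hausdorff.
  apply: continuous_compact; first exact: continuous_subspaceT.
  exact: compact_states_ge.
have nKphi : (~` (marg @` K)) (phi, psi).
  move=> [s [ss sc] [sA sB]].
  have : complex.Re (s T) <= alpha t phi psi T.
    apply: le_alpha => //; split; first exact: ss.1.
      by move=> x; rewrite -sA.
    by move=> y; rewrite -sB.
  by move: sc; rewrite /c => sc; lra.
have nK := open_nbhs_nbhs (conj (closed_openC closed_margK) nKphi).
apply: filterS nK => -[phi' psi'] /= nK phi'1.
have le_c s : couplings t phi' psi' s -> complex.Re (s T) <= c.
  move=> cs; rewrite leNgt; apply/negP => lts; apply: nK; exists s.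
    by split; [exact: coupling_is_state cs|exact: ltW].
  by case: cs => _ sA sB; congr pair; apply/funext; [exact: sA|exact: sB].
(* This settles the case without couplings, where the supremum is 0. *)
have c0 : 0 <= c by rewrite /c; lra.
suff : alpha t phi' psi' T <= c by rewrite /c; lra.
rewrite /alpha; set E := (X in sup X).
have [[x Ex]|/set0P/negP/negPn/eqP ->] := pselect (E !=set0).
  apply: ge_sup; first by exists x.
  by move=> _ [s cs <-]; exact: le_c.
by rewrite sup0.
Qed.

End Alpha.

(** * Orthonormal bases for faithful functionals *)

Section Orthonormal.
Context {R : realType} (A : cstarAlgType R) (phi : A -> R[i]).
Hypothesis phi_pos : positive_functional phi.
Hypothesis phi_def : forall x, phi (star x * x) = 0 -> x = 0.
Let lphi : scalar phi := phi_pos.1.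

Let innerZ x k y : phi (star x * (k *: y)) = k * phi (star x * y).
Proof. by rewrite -scalerAr scalar_mapZ. Qed.

Let innerB x y z : phi (star x * (y - z)) = phi (star x * y) - phi (star x * z).
Proof. by rewrite mulrBr scalar_mapB. Qed.

Let inner_sum x n (F : 'I_n -> A) :
  phi (star x * \sum_i F i) = \sum_i phi (star x * F i).
Proof. by rewrite mulr_sumr scalar_map_sum. Qed.

Let innerC x y : phi (star x * y) = (phi (star y * x))^*.
Proof. by rewrite -positive_functional_star // starM starK. Qed.

Definition orthonormal n (f : 'I_n -> A) : Prop :=
  forall i j, phi (star (f i) * f j) = (i == j)%:R.

(** For orthonormal [f] this is the orthogonal projection onto the span of [f], so [fourier f x = x]
    expresses that [x] lies in that span. *)
Definition fourier n (f : 'I_n -> A) (x : A) : A :=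
  \sum_i phi (star (f i) * x) *: f i.

Lemma fourier_inner n (f : 'I_n -> A) x j : orthonormal f ->
  phi (star (f j) * fourier f x) = phi (star (f j) * x).
Proof.
move=> of_; rewrite inner_sum (bigD1 j) //= innerZ of_ eqxx mulr1.
rewrite big1 ?addr0 //.
by move=> i ij; rewrite innerZ of_ eq_sym (negbTE ij) mulr0.
Qed.

Lemma fourier_lin n (f : 'I_n -> A) (I : Type) (r : seq I) (c : I -> R[i])
    (e : I -> A) : (forall i, fourier f (e i) = e i) ->
  fourier f (\sum_(i <- r) c i *: e i) = \sum_(i <- r) c i *: e i.
Proof.
move=> fe; rewrite /fourier -[RHS](eq_bigr _ (fun i _ => congr1 _ (fe i))).
rewrite /fourier; under [RHS]eq_bigr => i _ do rewrite scaler_sumr.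
rewrite exchange_big /=; apply: eq_bigr => j _.
rewrite mulr_sumr scalar_map_sum // scaler_suml; apply: eq_bigr => i _.
by rewrite innerZ scalerA.
Qed.

(** If [x] is outside the span of [f], the normalized residual of its projection is appended;
    otherwise [f] is kept. *)
Lemma gram_schmidt_step n (f : 'I_n -> A) x : orthonormal f ->
  exists m (g : 'I_m -> A), [/\ orthonormal g,
    fourier g x = x & forall y, fourier f y = y -> fourier g y = y].
Proof.
move=> of_; have [fx|fx] := eqVneq (fourier f x) x; first by exists n, f.
pose v := x - fourier f x.
have v0 : v != 0 by rewrite subr_eq0 eq_sym.
pose N := phi (star v * v).
have N0 : 0 < N.
  rewrite lt_neqAle positive_functional_ge0 // andbT eq_sym.
  by apply: contra_neq v0; exact: phi_def.
have sN0 : sqrtC N != 0 by rewrite sqrtC_eq0 gt_eqF.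
have sNN : sqrtC N * sqrtC N = N by rewrite -expr2 sqrtCK.
have sNV : (sqrtC N)^-1 * N = sqrtC N by rewrite -{2}sNN mulKf.
pose u := (sqrtC N)^-1 *: v.
have sNr : ((sqrtC N)^-1)^* = (sqrtC N)^-1.
  by rewrite conj_Creal // rpredV ger0_real // sqrtC_ge0 ltW.
have fv j : phi (star (f j) * v) = 0 by rewrite innerB fourier_inner // subrr.
have fu j : phi (star (f j) * u) = 0 by rewrite innerZ fv mulr0.
have uf j : phi (star u * f j) = 0 by rewrite innerC fu conjC0.
have vfour y : phi (star u * fourier f y) = 0.
  by rewrite inner_sum big1 // => i _; rewrite innerZ uf mulr0.
have uu : phi (star u * u) = 1.
  rewrite innerZ starZ sNr -scalerAl scalar_mapZ // -/N sNV.
  by rewrite mulVf.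
have ux : phi (star u * x) = sqrtC N.
  rewrite -[x](subrK (fourier f x)) -/v mulrDr scalar_mapD // vfour addr0.
  by rewrite starZ sNr -scalerAl scalar_mapZ // -/N.
(* The family [f] with [u] at the new last index. *)
pose g (i : 'I_n.+1) : A := oapp f u (unlift ord_max i).
have gl i : g (lift ord_max i) = f i by rewrite /g liftK.
have gm : g ord_max = u by rewrite /g unlift_none.
have gE y : fourier g y = fourier f y + phi (star u * y) *: u.
  rewrite /fourier big_ord_recr /= gm; congr (_ + _); apply: eq_bigr => i _.
  rewrite (_ : widen_ord _ i = lift ord_max i) ?gl //.
  by apply: val_inj; rewrite /= /bump leqNgt ltn_ord.
exists n.+1, g; split.
- move=> i j; case: (unliftP ord_max i) => [i'|] ->; rewrite ?gl ?gm;
  case: (unliftP ord_max j) => [j'|] ->; rewrite ?gl ?gm.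
  + by rewrite of_ (inj_eq lift_inj).
  + by rewrite fu eq_sym (negbTE (neq_lift _ _)).
  + by rewrite uf (negbTE (neq_lift _ _)).
  + by rewrite uu eqxx.
- by rewrite gE ux scalerA divff // scale1r addrC subrK.
- by move=> y fy; rewrite gE fy -{2}fy vfour scale0r addr0.
Qed.

(** Gram-Schmidt from the empty family along a spanning family, whose dependent members leave the
    orthonormal family unchanged. *)
Lemma orthonormal_basis : finite_dimensional A ->
  exists n (f : 'I_n -> A), orthonormal f /\ forall x, fourier f x = x.
Proof.
move=> [n [e espan]].
have step k : (k <= n)%N -> exists m (g : 'I_m -> A), orthonormal g /\
    forall i : 'I_n, (i < k)%N -> fourier g (e i) = e i.
  elim: k => [_|k IH kn].
    by exists 0%N, (fun=> 0); split=> // -[].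
  have [m [f [of_ fe]]] := IH (ltnW kn).
  have [p [g [og gk ge]]] := gram_schmidt_step (e (Ordinal kn)) of_.
  exists p, g; split=> // i; rewrite ltnS leq_eqVlt => /orP[/eqP ik|/fe/ge //].
  by rewrite (_ : i = Ordinal kn) //; exact: val_inj.
have [m [g [og ge]]] := step n (leqnn n).
exists m, g; split=> // x; have [c ->] := espan x.
by apply: fourier_lin => i; exact: ge.
Qed.

(** A functional is read as a matrix in the basis [f]. The matrix of [phi] is the identity, and that
    of a functional near [phi] is close to it. *)
Lemma scalar_fourier n (f : 'I_n -> A) (h : A -> R[i]) x : scalar h ->
  fourier f x = x ->
  h (star x * x) = \sum_i \sum_j (phi (star (f i) * x))^* *
    phi (star (f j) * x) * h (star (f i) * f j).
Proof.
move=> lh fx; rewrite -{1 2}fx /fourier (big_morph _ (@starD _ _) (@star0 _ _)).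
rewrite mulr_suml (scalar_map_sum lh); apply: eq_bigr => i _.
rewrite mulr_sumr (scalar_map_sum lh); apply: eq_bigr => j _.
by rewrite starZ -scalerAl -scalerAr !(scalar_mapZ lh) mulrA.
Qed.

End Orthonormal.

(** If the matrix entries of [phi'] and [phi] differ by less than [eta], their values at
    [star x * x] differ by at most [eta *+ n] times [phi (star x * x)], so [phi1] dominates a
    positive multiple of [phi] on squares. *)
Lemma near_state_dominates (R : realType) (A : cstarAlgType R)
    (phi : A -> R[i]) (e : R) :
  finite_dimensional A -> is_state phi -> is_faithful phi -> 0 < e ->
  \forall phi' \near (phi : {ptws A -> R[i]}), is_state phi' ->
    let phi1 x := phi' x - real_complex R (1 - e) * phi x in
    positive_functional phi1 /\ forall x, phi1 (star x * x) = 0 -> x = 0.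
Proof.
move=> fA [phi_pos phi1] faith e0.
have phi_def x : phi (star x * x) = 0 -> x = 0.
  by move=> x0; apply/star_mul_self_eq0/faith => //; exists x.
have [n [f [of_ fspan]]] := orthonormal_basis phi_pos phi_def fA.
(* Dividing by [n.+1] keeps [eta *+ n] strictly below [e]; the strictness makes [phi1] faithful. *)
pose eta : R := e / n.+1%:R.
have eta0 : 0 < eta by rewrite divr_gt0 ?ltr0n.
have eta_lt : eta *+ n < e.
  by rewrite -mulr_natr /eta mulrAC ltr_pdivrMr ?ltr0n // ltr_pM2l // ltr_nat.
have near_ij (ij : 'I_n * 'I_n) : \forall phi' \near (phi : {ptws A -> R[i]}),
    `|phi (star (f ij.1) * f ij.2) - phi' (star (f ij.1) * f ij.2)| <
      real_complex R eta.
  set x := star _ * _.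
  have : nbhs (phi x) [set z | `|phi x - z| < real_complex R eta].
    by apply/nbhs_normP; exists (real_complex R eta) => //=; rewrite ltcR.
  exact: (@continuous_eval R[i] A x phi).
apply: filterS (filter_forall (nbhs_filter _) near_ij).
move=> phi' near_f [phi'_pos _] /=.
have key x : real_complex R (e - eta *+ n) * phi (star x * x) <=
    phi' (star x * x) - real_complex R (1 - e) * phi (star x * x).
  set N := phi (star x * x); pose c i := phi (star (f i) * x).
  have NE : N = \sum_i `|c i| ^+ 2.
    rewrite /N (scalar_fourier phi_pos.1 (fspan x)); apply: eq_bigr => i _.
    rewrite (bigD1 i) //= of_ eqxx mulr1 big1 ?addr0 ?normCKC // => j ji.
    by rewrite of_ eq_sym (negbTE ji) mulr0.
  have : `|N - phi' (star x * x)| <= real_complex R (eta *+ n) * N.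
    rewrite {1}/N (scalar_fourier phi_pos.1 (fspan x)).
    rewrite (scalar_fourier phi'_pos.1 (fspan x)) -sumrB.
    rewrite (le_trans (ler_norm_sum _ _ _)) //.
    (* The bound is spread over all pairs of indices, so that each term is handled separately by the
       inequality of arithmetic and geometric means. *)
    have -> : real_complex R (eta *+ n) * N = \sum_(i < n) \sum_(j < n)
        real_complex R eta * ((`|c i| ^+ 2 + `|c j| ^+ 2) / 2).
      under eq_bigr => i _ do rewrite -mulr_sumr -mulr_suml big_split /=
        sumr_const card_ord -NE.
      rewrite -mulr_sumr -mulr_suml big_split /= sumrMnl -NE sumr_const.
      rewrite card_ord.
      by rewrite rmorphMn /= -mulr2n -[_ *+ 2]mulr_natr mulfK ?pnatr_eq0 //
        mulrnAl mulrnAr.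
    apply: ler_sum => i _; rewrite -sumrB.
    rewrite (le_trans (ler_norm_sum _ _ _)) //; apply: ler_sum => j _.
    rewrite -mulrBr normrM mulrC ler_pM //.
      exact/ltW/(near_f (i, j)).
    rewrite normrM norm_conjC -/(c i) -/(c j).
    rewrite ler_pdivlMr ?ltr0n // -subr_ge0.
    have -> : `|c i| ^+ 2 + `|c j| ^+ 2 - `|c i| * `|c j| * 2 =
      (`|c i| - `|c j|) ^+ 2 by ring.
    by rewrite -realEsqr rpredB // normr_real.
  rewrite real_ler_norml; last first.
    by rewrite rpredB // ger0_real // positive_functional_ge0.
  move=> /andP[_]; rewrite !rmorphB /= rmorph1 => le_N.
  rewrite -subr_ge0; move: le_N; rewrite -subr_ge0; congr (_ <= _); ring.
have e_eta : 0 < real_complex R (e - eta *+ n) by rewrite ltcR subr_gt0.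
split; last first.
  move=> x x0; apply: phi_def; have := key x; rewrite x0 => le0.
  apply/eqP; rewrite eq_le positive_functional_ge0 // andbT.
  by rewrite -(pmulr_rle0 _ e_eta).
split.
  by move=> k x y; rewrite phi_pos.1 phi'_pos.1; ring.
move=> _ [x ->]; rewrite (le_trans _ (key x)) // mulr_ge0 ?(ltW e_eta) //.
exact: positive_functional_ge0.
Qed.

(** * Finite-dimensional tensor products *)

Section FiniteSpan.
Context {R : realType} (C : cstarAlgType R).
Implicit Types (x y v : C) (s : seq C).

(** The recursive form lets an induction on the list peel off one coefficient at a time. *)
Fixpoint in_span s y : Prop :=
  if s is v :: s' then exists k : R[i], in_span s' (y - k *: v) else y = 0.

Lemma in_spanD s x y : in_span s x -> in_span s y -> in_span s (x + y).
Proof.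
elim: s x y => [|v s IH] x y /=; first by move=> -> ->; rewrite addr0.
move=> [k xk] [l yl]; exists (k + l).
by rewrite scalerDl opprD addrACA; exact: IH.
Qed.

Lemma in_spanZ s a x : in_span s x -> in_span s (a *: x).
Proof.
elim: s x => [|v s IH] x /=; first by move=> ->; rewrite scaler0.
by move=> [k xk]; exists (a * k); rewrite -scalerA -scalerBr; exact: IH.
Qed.

Lemma in_span0 s : in_span s 0.
Proof.
by elim: s => //= v s IH; exists 0; rewrite scale0r subr0.
Qed.

Lemma in_span_mem s v : v \in s -> in_span s v.
Proof.
elim: s => //= w s IH; rewrite inE => /orP[/eqP ->|/IH vs].
  by exists 1; rewrite scale1r subrr; exact: in_span0.
by exists 0; rewrite scale0r subr0.
Qed.

(* If [v] has distance [d > 0] to the span of [s], then [k v + x] with [x] in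
   that span has norm at least [|k| d], which bounds the coefficients of [v] in
   approximations of [y]; a cluster point of these is the coefficient of [v]
   in [y]. *)
Lemma in_span_closed s y :
  (forall e : R, 0 < e -> exists2 x, in_span s x & cnorm (y - x) < e) ->
  in_span s y.
Proof.
elim: s y => [|v s IH] y ycl.
  apply: cnorm0_eq0; apply/le_anti; rewrite cnorm_ge0 andbT.
  apply/ler_addgt0Pr => e /ycl [x ->]; rewrite subr0 add0r; exact: ltW.
have [vs|vNs] := pselect (in_span s v).
  exists 0; rewrite scale0r subr0; apply: IH => e /ycl [x [k xk] lte].
  exists x => //; rewrite -[x](subrK (k *: v)).
  by apply: in_spanD => //; exact: in_spanZ.
(* Otherwise [v] would be a limit of elements of the span of [s], which is closed by induction. *)
have [d d0 dist_v] : exists2 d : R, 0 < d &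
    forall x, in_span s x -> d <= cnorm (v - x).
  apply: contrapT => no_d; apply: vNs; apply: IH => e e0.
  apply: contrapT => no_x; apply: no_d; exists e => // x xs.
  by rewrite leNgt; apply/negP => lte; apply: no_x; exists x.
have dist_kv k x : in_span s x -> complex.Re `|k| * d <= cnorm (k *: v - x).
  move=> xs; have [->|k0] := eqVneq k 0.
    by rewrite normr0 mul0r cnorm_ge0.
  have -> : k *: v - x = k *: (v - k^-1 *: x).
    by rewrite scalerBr scalerA divff // scale1r.
  rewrite cnormZ ler_wpM2l ?dist_v //; last exact: in_spanZ.
  by have := normr_ge0 k; rewrite lecE => /andP[].
have /choice [c hc] (n : nat) : exists k : R[i],
    exists2 x, in_span s x & cnorm (y - (k *: v + x)) < n.+1%:R^-1.
  have [|z [k zk] zy] := ycl n.+1%:R^-1; first by rewrite invr_gt0 ltr0n.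
  by exists k, (z - k *: v); rewrite // addrCA subrr addr0.
(* By [dist_kv], the modulus of [c n] times [d] is at most the norm of the approximation, which is
   within 1 of [y]. *)
pose M := (cnorm y + 1) / d.
have cM n : complex_box M (c n).
  suff le_M : complex.Re `|c n| <= M.
    have : `|c n| <= real_complex R M.
      by rewrite -(RRe_real (normr_real (c n))) lecR.
    by move=> cnM; split; rewrite -lecR (le_trans _ cnM)
      ?normc_ge_Re ?normc_ge_Im.
  rewrite ler_pdivlMr //; have [x xs xlt] := hc n.
  have := dist_kv (c n) (- x); rewrite opprK => /(_ _)/le_trans; apply.
    by rewrite -scaleN1r; exact: in_spanZ.
  have := cnorm_triangle y (c n *: v + x) 0; rewrite !subr0 cnormBC => le1.
  by rewrite (le_trans le1) // addrC lerD2l (le_trans (ltW xlt)) //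
    invf_le1 ?ltr0n // ler1n.
have [k [_ clk]] := compact_complex_box (fmap_proper_filter c _)
  (filterE _ cM : (c @ \oo) (complex_box M)).
exists k; apply: IH => e e0.
(* The error is split in two: [e / 2] for the approximation of [y], and [e / 2] for replacing [c n]
   by [k] in front of [v]. *)
pose D := cnorm v + 1.
have D0 : 0 < D by have := cnorm_ge0 v; rewrite /D; lra.
have e1 : 0 < e / (2 * D) by rewrite divr_gt0 // mulr_gt0 // ltr0n.
have [N Ne] : exists N : nat, N.+1%:R^-1 < e / 2.
  have /cvgrPdist_lt /(_ (e / 2)) := @cvg_harmonic R.
  case=> [|N _ HN]; first by lra.
  exists N; have := HN N (leqnn N).
  by rewrite /= sub0r normrN ger0_norm // invr_ge0 ler0n.
have [||_ [[n /= Nn <-] nk]] := clk [set c n | n in [set n | (N <= n)%N]]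
    [set z | `|k - z| < real_complex R (e / (2 * D))].
- by exists N => // n /= Nn; exists n.
- apply/nbhs_normP; exists (real_complex R (e / (2 * D))) => //=.
  by rewrite ltcR.
have [x xs xlt] := hc n; exists x => //.
have -> : y - k *: v - x = (y - (c n *: v + x)) + (c n - k) *: v.
  rewrite scalerBl opprD -!addrA; congr (_ + _).
  by rewrite [RHS]addrCA addKr addrC.
rewrite (le_lt_trans (cnormD _ _)) // cnormZ distrC.
have kc : complex.Re `|k - c n| < e / (2 * D).
  by rewrite -ltcR RRe_real ?normr_real.
have : complex.Re `|k - c n| * cnorm v <= e / (2 * D) * D.
  rewrite ler_pM ?cnorm_ge0 ?(ltW kc) //; last by rewrite lerDl.
  by have := normr_ge0 (k - c n); rewrite lecE => /andP[].
have -> : e / (2 * D) * D = e / 2 by rewrite invfM mulrA mulfVK ?gt_eqF.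
move=> le2; rewrite [ltRHS]splitr ltr_leD // (lt_trans xlt) //.
by rewrite (le_lt_trans _ Ne) // lef_pV2 ?posrE ?ltr0n // ler_nat.
Qed.

End FiniteSpan.

(** * Product functionals on the tensor product *)

Section TensorProduct.
Context {R : realType} (A B C : cstarAlgType R) (t : {bilinear A -> B -> C}).
Hypothesis tt : is_cstar_tensor t.

Lemma tensor_sum_cat (V : lmodType R[i]) (f : {bilinear A -> B -> V}) s1 s2 :
  tensor_sum f (s1 ++ s2) = tensor_sum f s1 + tensor_sum f s2.
Proof. exact: big_cat. Qed.

Lemma tensor_sum_scale (V : lmodType R[i]) (f : {bilinear A -> B -> V}) k s :
  tensor_sum f [seq (k *: p.1, p.2) | p <- s] = k *: tensor_sum f s.
Proof.
rewrite /tensor_sum big_map scaler_sumr; apply: eq_bigr => p _.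
by rewrite linearZl_LR.
Qed.

(** The algebraic tensor product has dense image, and this image lies in the span of finitely many
    elementary tensors, which is closed; so every element is such a combination. *)
Lemma tensor_sum_surj : finite_dimensional A -> finite_dimensional B ->
  forall x, exists s, x = tensor_sum t s.
Proof.
move=> [n [e espan]] [m [f fspan]] x.
pose r := [seq t (e i) (f j) | i <- enum 'I_n, j <- enum 'I_m].
have span_t s : in_span r (tensor_sum t s).
  rewrite /tensor_sum; elim/big_ind: _ => [|y z|[a b] _ /=].
  - exact: in_span0.
  - exact: in_spanD.
  have [c ->] := espan a; have [d ->] := fspan b.
  rewrite linear_sumr; elim/big_ind: _ => [|y z|j _].
  - exact: in_span0.
  - exact: in_spanD.
  rewrite linearZr_LR; apply: in_spanZ.
  rewrite linear_sumlz; elim/big_ind: _ => [|y z|i _].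
  - exact: in_span0.
  - exact: in_spanD.
  rewrite linearZl_LR; apply: in_spanZ; apply: in_span_mem.
  by apply: allpairs_f; rewrite mem_enum.
have : in_span r x.
  apply: in_span_closed => eps /(tensor_dense tt x)[s lts].
  by exists (tensor_sum t s).
have : {in r, forall y, exists s, y = tensor_sum t s}.
  move=> _ /allpairsP[[i j] [_ _ ->]]; exists [:: (e i, f j)].
  by rewrite /tensor_sum big_seq1.
elim: r x {span_t} => [|v r IH] x rt /=.
  by move=> ->; exists [::]; rewrite /tensor_sum big_nil.
move=> [k /IH[|s xs]].
  by move=> y yr; apply: rt; rewrite inE yr orbT.
have [|s' vs'] := rt v; first exact: mem_head.
exists (s ++ [seq (k *: p.1, p.2) | p <- s']).
by rewrite tensor_sum_cat tensor_sum_scale -xs -vs' subrK.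
Qed.

Lemma tensor_factor (V : lmodType R[i]) (f : {bilinear A -> B -> V}) :
  (forall x, exists s, x = tensor_sum t s) ->
  exists h : C -> V, linear h /\ forall s, h (tensor_sum t s) = tensor_sum f s.
Proof.
move=> /choice[rep repE].
(* The value does not depend on the representative: a difference of two representatives is 0 in [C],
   hence 0 in the algebraic tensor product by [tensor_inj]. *)
have wd s1 s2 : tensor_sum t s1 = tensor_sum t s2 ->
    tensor_sum f s1 = tensor_sum f s2.
  move=> s12; apply/eqP; rewrite -subr_eq0 -scaleN1r -tensor_sum_scale.
  rewrite -tensor_sum_cat; apply/eqP; apply: (tensor_inj tt).
  by rewrite tensor_sum_cat tensor_sum_scale s12 scaleN1r subrr.
exists (fun x => tensor_sum f (rep x)); split=> [k x y|s].
  rewrite -tensor_sum_scale -tensor_sum_cat; apply: wd.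
  by rewrite tensor_sum_cat tensor_sum_scale -!repE.
by apply: wd; rewrite -repE.
Qed.

(** For positivity, [x] is written as the sum of [t (g i) (b i)] with [g] orthonormal for [phi]. The
    cross terms of [tau (star x * x)] vanish, and the sum of [psi (star (b i) * b i)] remains. *)
Lemma product_functional (phi : A -> R[i]) (psi : B -> R[i]) :
  finite_dimensional A -> finite_dimensional B ->
  positive_functional phi -> (forall x, phi (star x * x) = 0 -> x = 0) ->
  positive_functional psi ->
  exists tau : C -> R[i], positive_functional tau /\
    forall a b, tau (t a b) = phi a * psi b.
Proof.
move=> fA fB pphi dphi ppsi.
have bil : bilinear_for *:%R *:%R (fun a b => phi a * psi b : R[i]).
  split=> [b k x y|a k x y] /=.
    by rewrite pphi.1 mulrDl -mulrA.
  by rewrite ppsi.1 mulrDr mulrCA.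
pose f : {bilinear A -> B -> R[i]} := HB.pack (fun a b => phi a * psi b : R[i])
  (bilinear_isBilinear.Build R[i] A B R[i] *:%R *:%R
     (fun a b => phi a * psi b : R[i]) bil).
have surj := tensor_sum_surj fA fB.
have [tau [ltau tauE]] := tensor_factor f surj.
have tau_t a b : tau (t a b) = phi a * psi b.
  have := tauE [:: (a, b)]; rewrite /tensor_sum !big_seq1; exact.
exists tau; split=> //; split=> // _ [x ->].
have [n [g [og gspan]]] := orthonormal_basis pphi dphi fA.
have [b ->] : exists b : 'I_n -> B, x = \sum_i t (g i) (b i).
  have [s ->] := surj x; elim: s => [|p s [b bE]].
    exists (fun=> 0); rewrite /tensor_sum big_nil big1 // => i _.
    by rewrite linear0r.
  exists (fun i => phi (star (g i) * p.1) *: p.2 + b i).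
  rewrite /tensor_sum big_cons -/(tensor_sum t s) bE.
  (* Moving the coefficients back to the first factor reassembles the Fourier expansion of [p.1]. *)
  under [RHS]eq_bigr => i _ do rewrite linearDr linearZr_LR -linearZl_LR.
  by rewrite big_split /= -linear_sumlz -/(fourier phi g p.1) gspan.
rewrite (big_morph _ (@starD _ _) (@star0 _ _)) mulr_suml.
rewrite (scalar_map_sum ltau); apply: sumr_ge0 => i _.
rewrite mulr_sumr (scalar_map_sum ltau); apply: sumr_ge0 => j _.
rewrite -(tensor_star tt) -(tensorM tt) tau_t og.
have [->|_] := eqVneq i j; last by rewrite mul0r.
by rewrite mul1r positive_functional_ge0.
Qed.

End TensorProduct.

(** * Lower semicontinuity *)

Lemma alpha_lower_semicontinuous (R : realType) (A B C : cstarAlgType R)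
    (t : {bilinear A -> B -> C}) (tt : is_cstar_tensor t)
    (phi : A -> R[i]) (psi : B -> R[i]) (T : C) (b : R) :
  positive T -> finite_dimensional A -> finite_dimensional B ->
  is_state phi -> is_faithful phi -> is_state psi -> is_faithful psi ->
  b < alpha t phi psi T ->
  \forall p \near ((phi, psi) : {ptws A -> R[i]} * {ptws B -> R[i]}),
    is_state p.1 -> is_state p.2 -> b < alpha t p.1 p.2 T.
Proof.
move=> pT fA fB sphi fphi spsi fpsi ltb.
have nearF := nbhs_filter ((phi, psi) : {ptws A -> R[i]} * {ptws B -> R[i]}).
(* A negative [b] is below every value of [alpha]. For [b >= 0], the strict inequality rules out an
   empty set of couplings, whose supremum is 0. *)
have [b0|b0] := ltP b 0.
  apply: (@filterE _ _ nearF) => p _ _.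
  by rewrite (lt_le_trans b0) // alpha_ge0.
have [s cs lts] : exists2 s, couplings t phi psi s & b < complex.Re (s T).
  have [[x Ex]|/set0P/negP/negPn/eqP E0] := pselect
    ([set complex.Re (s T) | s in couplings t phi psi] !=set0).
    by have [_ [s cs <-]] := sup_gt (ex_intro _ x Ex) ltb; exists s.
  by move: ltb; rewrite /alpha E0 sup0 ltNge b0.
have [ps sA sB] := cs.
set r := complex.Re (s T) in lts.
have r0 : 0 < r by exact: le_lt_trans lts.
(* Chosen so that [(1 - e) * r] is the midpoint of [b] and [r], still above [b]. *)
pose e := (r - b) / (2 * r).
have e0 : 0 < e by rewrite divr_gt0 ?subr_gt0 // mulr_gt0 // ltr0n.
have er : (1 - e) * r = (r + b) / 2.
  by rewrite /e; field; rewrite gt_eqF.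
have e1 : 0 <= 1 - e by rewrite -(pmulr_lge0 _ r0) er; lra.
have nA : \forall p \near ((phi, psi) : {ptws A -> R[i]} * {ptws B -> R[i]}),
    is_state p.1 -> let phi1 x := p.1 x - real_complex R (1 - e) * phi x in
    positive_functional phi1 /\ forall x, phi1 (star x * x) = 0 -> x = 0.
  exact: (cvg_fst (near_state_dominates fA sphi fphi e0)).
have nB : \forall p \near ((phi, psi) : {ptws A -> R[i]} * {ptws B -> R[i]}),
    is_state p.2 -> let psi1 x := p.2 x - real_complex R (1 - e) * psi x in
    positive_functional psi1 /\ forall x, psi1 (star x * x) = 0 -> x = 0.
  exact: (cvg_snd (near_state_dominates fB spsi fpsi e0)).
apply: (@filterS2 _ _ nearF _ _ _ _ nA nB) => p {}nA {}nB sphi' spsi'.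
case: p => phi' psi' /= in nA nB sphi' spsi' *.
have [pphi1 dphi1] := nA sphi'; have [ppsi1 _] := nB spsi'.
have [tau [ptau tauE]] := product_functional tt fA fB pphi1 dphi1 ppsi1.
(* Both remainders, [phi1] and [psi1], take the value [e] at 1, so the marginals of [tau] are [e]
   times these remainders; the factor [e^-1] corrects this. *)
pose s' x := real_complex R (1 - e) * s x + real_complex R e^-1 * tau x.
have e_neq0 : real_complex R e != 0 by rewrite gt_eqF // ltcR.
have eVE : real_complex R e^-1 = (real_complex R e)^-1 by rewrite fmorphV.
have ptT : 0 <= tau T by exact: ptau.2.
have cs' : couplings t phi' psi' s'.
  split.
  - split=> [k x y|x px]; first by rewrite /s' ps.1 ptau.1; ring.
    by rewrite addr_ge0 // mulr_ge0 ?ps.2 ?ptau.2 ?ler0c // invr_ge0 ltW.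
  - move=> a; rewrite /s' tauE sA spsi.2 spsi'.2 eVE rmorphB rmorph1 /=.
    by field.
  - move=> y; rewrite /s' tauE sB sphi.2 sphi'.2 eVE rmorphB rmorph1 /=.
    by field.
apply: lt_le_trans (le_alpha (tensor1 tt) T sphi'.2 cs').
have b_lt : b < (1 - e) * r by rewrite er; lra.
rewrite (lt_le_trans b_lt) // -lecR.
have sT : 0 <= s T by exact: ps.2.
case: cs' => ps' _ _.
have -> : real_complex R (complex.Re (s' T)) = s' T.
  by rewrite RRe_real // ger0_real // ps'.2.
rewrite rmorphM /= RRe_real ?ger0_real // /s' lerDl.
by rewrite mulr_ge0 // ler0c invr_ge0 ltW.
Qed.

(** * Semicontinuity restricted to the spaces of states *)

Theorem proposition2p13 (R : realType) (A B C : cstarAlgType R)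
    (t : {bilinear A -> B -> C}) (ht : is_min_cstar_tensor t)
    (T : C) (T_pos : positive T) (T_contr : cnorm T <= 1) :
  upper_semicontinuous
    (fun p : states A * states B => alpha t (val p.1) (val p.2) T) /\
  (finite_dimensional A -> finite_dimensional B ->
   continuous (fun p : faithful_states A * faithful_states B =>
                 alpha t (val p.1) (val p.2) T)).
Proof.
have tt := ht.1.
(* Pulls neighbourhoods in the ambient function spaces back to pairs of states or of faithful
   states. *)
have val_pair (X Y : topologicalType) (D : set X) (E : set Y) :
    continuous (fun p : D * E => (val p.1, val p.2) : X * Y).
  have cval (Z : topologicalType) (F : set Z) : continuous (val : F -> Z).
    exact: initial_continuous.
  have c1 : continuous (fun p : D * E => val p.1).
    by move=> p; apply: continuous_comp; [exact: cvg_fst|exact: cval].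
  have c2 : continuous (fun p : D * E => val p.2).
    by move=> p; apply: continuous_comp; [exact: cvg_snd|exact: cval].
  by move=> p; exact: (cvg_pair (c1 p) (c2 p)).
split=> [p a lta|fA fB p].
  have [_ p1] : is_state (val p.1) := set_valP p.1.
  have near_usc := alpha_upper_semicontinuous (tensor1 tt) T_pos p1 lta.
  apply: (@filterS _ _ (nbhs_filter p) _ _ _ (val_pair _ _ _ _ p _ near_usc)).
  move=> q; apply.
  by have [] : is_state (val q.1) := set_valP q.1.
have [sA faithA] : is_state (val p.1) /\ is_faithful (val p.1) := set_valP p.1.
have [sB faithB] : is_state (val p.2) /\ is_faithful (val p.2) := set_valP p.2.
apply/(@cvgrPdist_lt _ _ _ (nbhs p)) => e e0.
set v := alpha t (val p.1) (val p.2) T.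
have lt_v : v - e < v by rewrite gtrBl.
have gt_v : v < v + e by rewrite ltrDl.
have near_usc := alpha_upper_semicontinuous (tensor1 tt) T_pos sA.2 gt_v.
have near_lsc :=
  alpha_lower_semicontinuous tt T_pos fA fB sA faithA sB faithB lt_v.
apply: (@filterS2 _ _ (nbhs_filter p) _ _ _ _ (val_pair _ _ _ _ p _ near_usc)
  (val_pair _ _ _ _ p _ near_lsc)) => q usc_q lsc_q.
have [sqA _] : is_state (val q.1) /\ is_faithful (val q.1) := set_valP q.1.
have [sqB _] : is_state (val q.2) /\ is_faithful (val q.2) := set_valP q.2.
rewrite ltr_distlC; apply/andP; split; first exact: lsc_q.
exact: usc_q sqA.2.
Qed.
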